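(* Let $v,w\in\mathfrak{S}_n$ and let $j_1,\dots,j_m\in\{1,\dots,n-1\}$. Suppose that $w=vs_{j_1}s_{j_2}\cdots s_{j_m}$ or $w=s_{j_1}s_{j_2}\cdots s_{j_m}v$, with $\ell(w)-\ell(v)=m$. Then $j_1,\dots,j_m$ are distinct if and only if $Q_{v,w}$ is toric.
   Context: $\mathfrak{S}_n$ is the symmetric group on $\{1,\dots,n\}$ with product given by composition $(uz)(k)=u(z(k))$, $s_i=(i,i+1)$ are the simple transpositions, $\ell(\cdot)$ is the length with respect to them, and $\le$ is Bruhat order (the hypothesis implies $v\le w$). For $v\le w$, the Bruhat interval polytope $Q_{v,w}$ is the convex hull in $\mathbb{R}^n$ of the points $(z(1),\dots,z(n))$ for $z\in\mathfrak{S}_n$ with $v\le z\le w$. $Q_{v,w}$ is called toric if $\dim Q_{v,w}=\ell(w)-\ell(v)$. *)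

(* Defs.v *)
From HB Require Import structures.
From mathcomp Require Import all_boot all_order all_fingroup all_algebra.
From mathcomp Require Import boolp classical_sets reals convex.

Set Implicit Arguments.
Unset Strict Implicit.
Unset Printing Implicit Defensive.

Import Order.TTheory GRing.Theory Num.Theory.

Local Open Scope ring_scope.
Local Open Scope classical_set_scope.

(* {1, ..., n} is represented by 'I_n = {0, ..., n - 1}, with k standing for
   k + 1; likewise {1, ..., n - 1} is represented by 'I_n.-1. *)

(* MathComp composes permutations from left to right, [(z * u) k = u (z k)];
   [perm_comp] is the right-to-left product, [perm_comp u z k = u (z k)]. *)
Definition perm_comp (n : nat) (u z : 'S_n) : 'S_n := (z * u)%g.

Lemma perm_compE (n : nat) (u z : 'S_n) (k : 'I_n) : perm_comp u z k = u (z k).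
Proof. by rewrite permM. Qed.

Lemma simple_lo_subproof (n : nat) (i : 'I_n.-1) : (i < n)%N.
Proof. exact: leq_trans (ltn_ord i) (leq_pred n). Qed.

Lemma simple_hi_subproof (n : nat) (i : 'I_n.-1) : (i.+1 < n)%N.
Proof. by case: n i => [|n] [i]. Qed.

Definition simple_transp (n : nat) (i : 'I_n.-1) : 'S_n :=
  tperm (Ordinal (simple_lo_subproof i)) (Ordinal (simple_hi_subproof i)).

Definition word_prod (n : nat) (s : seq 'I_n.-1) : 'S_n :=
  \big[@perm_comp n/1%g]_(i <- s) simple_transp i.

Definition has_word (n : nat) (u : 'S_n) (k : nat) : bool :=
  [exists s : k.-tuple 'I_n.-1, u == word_prod s].

Lemma word_prod_cat (n : nat) (s t : seq 'I_n.-1) :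
  word_prod (s ++ t) = perm_comp (word_prod s) (word_prod t).
Proof.
rewrite /word_prod; elim: s => [|i s IHs] /=.
  by rewrite big_nil /perm_comp mulg1.
by rewrite !big_cons IHs /perm_comp mulgA.
Qed.

Lemma tperm_word (n d : nat) (i j : 'I_n) :
  (i + d)%N = j -> exists s, tperm i j = word_prod s.
Proof.
elim: d j => [|d IHd] j dij.
  exists [::]; rewrite /word_prod big_nil.
  by rewrite (_ : i = j) ?tperm1 //; apply/val_inj; rewrite /= -dij addn0.
have jn1 : (i + d < n.-1)%N.
  have n_gt0 : (0 < n)%N by apply: leq_ltn_trans (ltn_ord i).
  by rewrite -ltnS prednK // -addnS dij.
pose a := Ordinal jn1.
have aj : Ordinal (simple_hi_subproof a) = j.
  by apply/val_inj; rewrite /= -dij addnS.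
have [s Es] := IHd (Ordinal (simple_lo_subproof a)) erefl.
case: (eqVneq d 0%N) => [d0|d_neq0].
  exists [:: a]; rewrite /word_prod big_cons big_nil /perm_comp mul1g.
  rewrite /simple_transp aj; congr tperm.
  by apply/val_inj; rewrite /= d0 addn0.
exists ([:: a] ++ s ++ [:: a]); rewrite !word_prod_cat -Es.
have -> : word_prod [:: a] = tperm (Ordinal (simple_lo_subproof a)) j.
  by rewrite /word_prod big_cons big_nil /perm_comp mul1g /simple_transp aj.
set b := Ordinal (simple_lo_subproof a).
rewrite /perm_comp -mulgA -{1}[tperm b j]tpermV -conjgE tpermJ tpermL.
congr tperm; rewrite tpermD //; apply/eqP => /(congr1 val) /=.
  by move/eqP; rewrite -[X in _ == X]addn0 eqn_add2l (negPf d_neq0).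
by rewrite -dij => /eqP; rewrite -[X in _ == X]addn0 eqn_add2l.
Qed.

Lemma has_word_ex (n : nat) (u : 'S_n) : exists k, has_word u k.
Proof.
suff [s ->] : exists s, u = word_prod s.
  by exists (size s); apply/existsP; exists (in_tuple s).
have [ts -> _] := prod_tpermP u; elim: ts => [|[i j] ts [s IHs]].
  by exists [::]; rewrite /word_prod !big_nil.
have [t Et] : exists t, tperm i j = word_prod t.
  case: (leqP i j) => [|/ltnW] le_ij.
    by apply: (@tperm_word n (j - i)); rewrite subnKC.
  by rewrite tpermC; apply: (@tperm_word n (i - j)); rewrite subnKC.
by exists (s ++ t); rewrite big_cons /= IHs Et word_prod_cat.
Qed.

Definition perm_length (n : nat) (u : 'S_n) : nat := ex_minn (has_word_ex u).

Definition bruhat_step (n : nat) (u w : 'S_n) : bool :=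
  [exists i : 'I_n, exists j : 'I_n, (i != j) && (w == perm_comp u (tperm i j))]
  && (perm_length u < perm_length w)%N.

Definition bruhat_le (n : nat) : rel 'S_n := connect (@bruhat_step n).

Definition perm_point (R : realType) (n : nat) (z : 'S_n) : 'rV[R]_n :=
  \row_(i < n) (z i).+1%:R.

Definition convex_hull (R : realType) (n : nat) (A : set 'rV[R]_n) :
    set 'rV[R]_n :=
  smallest (@convex_set R 'rV[R]_n) A.

Definition bruhat_interval_polytope (R : realType) (n : nat) (v w : 'S_n) :
    set 'rV[R]_n :=
  convex_hull [set perm_point R z | z in
    [set z : 'S_n | bruhat_le v z /\ bruhat_le z w]].
Arguments bruhat_interval_polytope R {n} v w.

Definition affine_hull (R : realType) (n : nat) (A : set 'rV[R]_n) :
    set 'rV[R]_n :=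
  [set y | exists (k : nat) (a : 'I_k -> R) (x : 'I_k -> 'rV[R]_n),
    [/\ forall i, A (x i), \sum_(i < k) a i = 1
      & y = \sum_(i < k) a i *: x i]].

(* The dimension is a relation between a set and a natural number; no number is
   a dimension of the empty set. *)
Definition has_dim (R : realType) (n : nat) (A : set 'rV[R]_n) (d : nat) :
    Prop :=
  exists (x : 'rV[R]_n) (U : {vspace 'rV[R]_n}),
    affine_hull A = [set x + u | u in [set` U]] /\ \dim U = d.

(* The truncated subtraction is harmless: the polytope is empty unless
   [bruhat_le v w], in which case [perm_length v <= perm_length w]. *)
Definition toric (R : realType) (n : nat) (v w : 'S_n) : Prop :=
  has_dim (bruhat_interval_polytope R v w) (perm_length w - perm_length v).

(* Main.v *)
From HB Require Import structures.
Require Import Defs.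
From mathcomp Require Import all_boot all_fingroup all_algebra.
From mathcomp Require Import classical_sets reals interval_inference convex.
From mathcomp Require Import zify.

Set Implicit Arguments.
Unset Strict Implicit.
Unset Printing Implicit Defensive.

Import GRing.Theory Num.Theory.

(** The direction space of the affine hull of the polytope can be computed
    exactly: it is spanned by one vector per distinct letter of the word, and
    these vectors are independent.  So the dimension is the number of distinct
    letters, while being toric asks for it to be [m].

    Write [w = a u b] with [u] the product of the word and [v = a b], where
    [b = 1] when the word stands on the right of [v], and [a = 1] when it stands
    on the left.  Number the coordinates so that [e_l] is the unit vector at
    position [b^-1 l]; the vectors in question are the simple roots
    [e_i - e_(i+1)], one for each letter [i].

    The directions lie in the span of the roots.  Call [p] a cut if no letter
    exchanges the values on both sides of [p], so that [u] preserves
    [{0, ..., p - 1}].  The number of positions below [p] carrying a value at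
    least [k] cannot decrease along the Bruhat order ([card_above_bruhat]): a
    step exchanges the values of an increasing pair, by the exchange property
    of words ([word_exchange]).  With [p] a cut (word on the right) or
    [k] a cut (word on the left), this number takes the same value at [v] and at
    [w], hence it is constant on the interval, and every element of the interval
    is [a y b] with [y] preserving all the blocks between cuts
    ([interval_right_coset], [interval_left_coset]).  Inside a block the unit
    vectors are congruent modulo the roots, so moving coordinates by [y] changes
    the point by a combination of roots ([perm_point_block]).

    The roots are directions.  Since lengths add up, the partial products of
    the word form a chain in the interval, and each edge of the chain is a
    nonzero multiple of some [e - e'].  On the right the edges are the simple
    roots themselves; on the left they are their images under the letters
    already read, which is harmless modulo the roots already obtained
    ([directions_right], [directions_left]). *)

(** * Words and length *)

Definition lo n (i : 'I_n.-1) : 'I_n := Ordinal (simple_lo_subproof i).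
Definition hi n (i : 'I_n.-1) : 'I_n := Ordinal (simple_hi_subproof i).

Lemma word_prod_nil n : word_prod [::] = 1%g :> 'S_n.
Proof. by rewrite /word_prod big_nil. Qed.

Lemma word_prod_cons n (a : 'I_n.-1) s :
  word_prod (a :: s) = perm_comp (simple_transp a) (word_prod s).
Proof. by rewrite /word_prod big_cons. Qed.

Lemma word_prod1 n (a : 'I_n.-1) : word_prod [:: a] = simple_transp a.
Proof. by rewrite word_prod_cons word_prod_nil /perm_comp mul1g. Qed.

Lemma perm_length_le n (s : seq 'I_n.-1) :
  (perm_length (word_prod s) <= size s)%N.
Proof.
rewrite /perm_length; case: ex_minnP => k _; apply.
by apply/existsP; exists (in_tuple s).
Qed.

Lemma reduced_word n (u : 'S_n) :
  exists2 s, u = word_prod s & size s = perm_length u.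
Proof.
rewrite /perm_length; case: ex_minnP => k /existsP[s /eqP us] _.
by exists s; rewrite ?size_tuple.
Qed.

Lemma perm_length_comp n (u z : 'S_n) :
  (perm_length (perm_comp u z) <= perm_length u + perm_length z)%N.
Proof.
have [s -> <-] := reduced_word u; have [t -> <-] := reduced_word z.
by rewrite -word_prod_cat -size_cat perm_length_le.
Qed.

Lemma simple_flip n (a : 'I_n.-1) (x y : 'I_n) :
    (x < y)%N -> (simple_transp a y < simple_transp a x)%N ->
  x = lo a /\ y = hi a.
Proof.
move=> ltxy flip; suff [Ex Ey] : val x = a /\ val y = a.+1.
  by split; apply: val_inj.
have neqE (u v : 'I_n) : u <> v -> val u <> val v by move=> + /val_inj.
move: flip ltxy; rewrite /simple_transp.
case: tpermP => [->|->|/neqE /= xl /neqE /= xh];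
  case: tpermP => [->|->|/neqE /= yl /neqE /= yh] /=; lia.
Qed.

(** Reading the word from the right, the images of [i] and [j] start in
    increasing order and end in decreasing order; the letter at which the order
    flips exchanges two neighbouring values, and so may be deleted. *)
Lemma word_exchange n (s : seq 'I_n.-1) (i j : 'I_n) :
    (i < j)%N -> (word_prod s j < word_prod s i)%N ->
  exists2 t, perm_comp (word_prod s) (tperm i j) = word_prod t
           & (size t < size s)%N.
Proof.
move=> ltij; elim: s => [|a s IHs].
  by rewrite word_prod_nil !perm1 => /ltn_trans/(_ ltij); rewrite ltnn.
rewrite word_prod_cons !perm_compE => flip.
have [ltji | leij] := ltnP (word_prod s j) (word_prod s i).
  have [t Et lets] := IHs ltji.
  exists (a :: t) => //.
  by rewrite word_prod_cons -Et /perm_comp mulgA.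
exists s => //.
have [Ei Ej] : word_prod s i = lo a /\ word_prod s j = hi a.
  apply: simple_flip flip; rewrite ltn_neqAle leij andbT.
  by apply/eqP => /val_inj/perm_inj Eij; move: ltij; rewrite Eij ltnn.
rewrite /perm_comp mulgA /simple_transp -/(lo a) -/(hi a) -Ei -Ej.
by rewrite -tpermJ conjgE !mulgA mulgK tperm2 mul1g.
Qed.

(** Otherwise the exchange property would shorten a reduced word of [u] to a
    word of the longer permutation. *)
Lemma bruhat_step_ltn n (u : 'S_n) (i j : 'I_n) :
    (i < j)%N -> (perm_length u < perm_length (perm_comp u (tperm i j)))%N ->
  (u i < u j)%N.
Proof.
move=> ltij lenlt.
have [// | geij] := ltnP (u i) (u j).
have ltji : (u j < u i)%N.
  rewrite ltn_neqAle geij andbT; apply/eqP => /val_inj/perm_inj Eij.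
  by move: ltij; rewrite Eij ltnn.
have [s Es szs] := reduced_word u.
have [|t Et szt] := @word_exchange n s i j ltij; first by rewrite -Es.
by have := perm_length_le t; rewrite -Et -Es; lia.
Qed.

(** * A weak monotone statistic of the Bruhat order *)

Definition above n (u : 'S_n) (p k : nat) : {set 'I_n} :=
  [set i : 'I_n | (i < p)%N && (k <= u i)%N].

Definition keeps n (u : 'S_n) (p : nat) := forall i, (u i < p)%N = (i < p)%N.

Lemma keepsM n (u z : 'S_n) p :
  keeps u p -> keeps z p -> keeps (perm_comp u z) p.
Proof. by move=> ku kz i; rewrite perm_compE ku kz. Qed.

Lemma keeps_tperm n (i j : 'I_n) p :
  (i < p)%N = (j < p)%N -> keeps (tperm i j) p.
Proof. by move=> Eij k; case: tpermP => // ->. Qed.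

Lemma card_above_keeps n (u z : 'S_n) p k :
  keeps z p -> #|above (perm_comp u z) p k| = #|above u p k|.
Proof.
move=> kz; rewrite -(card_imset (above (perm_comp u z) p k) (@perm_inj _ z)).
congr #|pred_of_set _|; apply/setP => i.
apply/imsetP/idP => [[l] | ].
  by rewrite !inE perm_compE => /andP[lp kl] ->; rewrite kz lp.
rewrite inE => /andP[ip ki]; exists ((z^-1)%g i); last by rewrite permKV.
by rewrite inE perm_compE permKV ki andbT -kz permKV.
Qed.

(** If [p] separates the exchanged positions [i < j], the value at [i] grows and
    nothing else below [p] changes; if not, the positions below [p] are merely
    permuted. *)
Lemma card_above_step n (u w : 'S_n) p k :
  bruhat_step u w -> (#|above u p k| <= #|above w p k|)%N.
Proof.
case/andP=> /existsP[i /existsP[j /andP[neij /eqP->]]].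
wlog ltij : i j neij / (i < j)%N => [wl | ].
  have [/wl|/wl|/val_inj Eij] := ltngtP i j; [exact | | by rewrite Eij eqxx in neij].
  by rewrite tpermC eq_sym; apply.
move=> /(bruhat_step_ltn ltij) ltu.
have [/andP[ip pj] | sameside] := boolP ((i < p)%N && (p <= j)%N); last first.
  by rewrite card_above_keeps //; apply: keeps_tperm; lia.
apply/subset_leq_card/fintype.subsetP => l; rewrite !inE perm_compE.
case/andP=> lp kl; rewrite lp /=.
case: tpermP => [El | El | //]; first by move: kl; rewrite El; lia.
by move: lp; rewrite El; lia.
Qed.

Lemma card_above_bruhat n (u w : 'S_n) p k :
  bruhat_le u w -> (#|above u p k| <= #|above w p k|)%N.
Proof.
case/connectP=> s; elim: s u => [|x s IHs] u /=; first by move=> _ ->.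
case/andP=> ux xs Ew.
exact: leq_trans (card_above_step p k ux) (IHs _ xs Ew).
Qed.

(** The statistic recovers which values are placed below position [p] and, in
    [card_above_position], which positions carry a value at least [k]. *)
Lemma card_above_value n (u : 'S_n) p (x : 'I_n) :
  #|above u p x| = (((u^-1)%g x < p) + #|above u p x.+1|)%N.
Proof.
rewrite (cardsD1 ((u^-1)%g x)) !inE permKV leqnn andbT; congr addn.
congr #|pred_of_set _|; apply/setP => i; rewrite !inE.
by rewrite -(inj_eq (@perm_inj _ u)) permKV -val_eqE /=; lia.
Qed.

Lemma card_above_position n (u : 'S_n) (p : 'I_n) k :
  #|above u p.+1 k| = ((k <= u p) + #|above u p k|)%N.
Proof.
rewrite (cardsD1 p) !inE ltnS leqnn /=; congr addn.
by congr #|pred_of_set _|; apply/setP => i; rewrite !inE -val_eqE /=; lia.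
Qed.

(** * The interval stays in a parabolic coset *)

Definition cut n (s : seq 'I_n.-1) (p : nat) := forall a, a \in s -> p != a.+1.

Lemma keeps_word n (s : seq 'I_n.-1) p : cut s p -> keeps (word_prod s) p.
Proof.
elim: s => [|a s IHs] cs; first by rewrite word_prod_nil => i; rewrite perm1.
rewrite word_prod_cons; apply: keepsM.
  apply: keeps_tperm => /=.
  have := cs a; rewrite inE eqxx => /(_ isT); lia.
by apply: IHs => b bs; apply: cs; rewrite inE bs orbT.
Qed.

(** Membership in the parabolic subgroup generated by the letters of [s],
    expressed by the invariant sets rather than by a word. *)
Definition block_perm n (s : seq 'I_n.-1) (y : 'S_n) :=
  forall p, cut s p -> keeps y p.

(** For a cut [p] the statistic agrees at [v] and [w] for every [k], hence on the
    interval, so all its elements place the same set of values below [p]. *)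
Lemma interval_right_coset n (s : seq 'I_n.-1) (v z : 'S_n) :
    bruhat_le v z -> bruhat_le z (perm_comp v (word_prod s)) ->
  exists2 y, z = perm_comp v y & block_perm s y.
Proof.
move=> vz zw; exists (perm_comp v^-1 z)%g; first by rewrite /perm_comp mulgKV.
move=> p cp.
have Eabove k : #|above z p k| = #|above v p k|.
  apply/eqP; rewrite eqn_leq (card_above_bruhat p k vz) andbT.
  by rewrite -(card_above_keeps v k (keeps_word cp)) card_above_bruhat.
have Einv x : ((v^-1)%g x < p)%N = ((z^-1)%g x < p)%N.
  have := card_above_value z p x; rewrite !Eabove card_above_value.
  by move=> /addIn; do 2!case: (_ < _)%N.
by move=> i; rewrite perm_compE Einv permK.
Qed.

(** Dual to the previous lemma, with the cut taken among the values: all the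
    elements of the interval place the values below the cut at the same
    positions. *)
Lemma interval_left_coset n (s : seq 'I_n.-1) (v z : 'S_n) :
    bruhat_le v z -> bruhat_le z (perm_comp (word_prod s) v) ->
  exists2 y, z = perm_comp y v & block_perm s y.
Proof.
move=> vz zw; exists (perm_comp z v^-1)%g; first by rewrite /perm_comp mulKVg.
move=> k ck.
have kw := keeps_word ck.
have Eabove p : #|above z p k| = #|above v p k|.
  apply/eqP; rewrite eqn_leq (card_above_bruhat p k vz) andbT.
  apply: leq_trans (card_above_bruhat p k zw) _.
  apply/eq_leq; congr #|pred_of_set _|; apply/setP => i.
  by rewrite !inE perm_compE !(leqNgt k) kw.
have Eval i : (k <= v i)%N = (k <= z i)%N.
  have := card_above_position z i k; rewrite !Eabove card_above_position.
  by move=> /addIn; do 2!case: (_ <= _)%N.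
by move=> i; rewrite perm_compE !ltnNge -Eval permKV.
Qed.

(** * Chains *)

Lemma bruhat_le_tperm n (x : 'S_n) (i j : 'I_n) : i != j ->
    (perm_length x < perm_length (perm_comp x (tperm i j)))%N ->
  bruhat_le x (perm_comp x (tperm i j)).
Proof.
move=> neij lt; apply/connect1/andP; split=> //.
by apply/existsP; exists i; apply/existsP; exists j; rewrite neij eqxx.
Qed.

Lemma lo_neq_hi n (a : 'I_n.-1) : lo a != hi a.
Proof. by rewrite -val_eqE /= neq_ltn ltnSn. Qed.

Lemma left_simple n (x : 'S_n) (a : 'I_n.-1) :
  perm_comp (simple_transp a) x
  = perm_comp x (tperm ((x^-1)%g (lo a)) ((x^-1)%g (hi a))).
Proof. by rewrite -tpermJ conjgE invgK /perm_comp !mulgA mulgKV. Qed.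

Lemma perm_length_simple n (a : 'I_n.-1) : (perm_length (simple_transp a) <= 1)%N.
Proof. by rewrite -word_prod1 perm_length_le. Qed.

(** A simple transposition adds at most one to the length, so if lengths add up
    then every letter lengthens the permutation. *)
Lemma bruhat_le_right n (x : 'S_n) (s : seq 'I_n.-1) :
    perm_length (perm_comp x (word_prod s)) = (perm_length x + size s)%N ->
  bruhat_le x (perm_comp x (word_prod s)).
Proof.
elim: s x => [|a s IHs] x; first by rewrite word_prod_nil /perm_comp mul1g => _; apply: connect0.
rewrite word_prod_cons.
have -> : perm_comp x (perm_comp (simple_transp a) (word_prod s))
          = perm_comp (perm_comp x (simple_transp a)) (word_prod s).
  by rewrite /perm_comp mulgA.
move=> /= El.
have l1 := perm_length_comp x (simple_transp a).
have l2 := perm_length_comp (perm_comp x (simple_transp a)) (word_prod s).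
have l3 := perm_length_simple a; have l4 := perm_length_le s.
apply: connect_trans (IHs _ _); last by lia.
by apply: bruhat_le_tperm; [exact: lo_neq_hi | rewrite -/(simple_transp a); lia].
Qed.

Lemma bruhat_le_left n (x : 'S_n) (s : seq 'I_n.-1) :
    perm_length (perm_comp (word_prod s) x) = (perm_length x + size s)%N ->
  bruhat_le x (perm_comp (word_prod s) x).
Proof.
elim: s => [|a s IHs]; first by rewrite word_prod_nil /perm_comp mulg1 => _; apply: connect0.
rewrite word_prod_cons.
have -> : perm_comp (perm_comp (simple_transp a) (word_prod s)) x
          = perm_comp (simple_transp a) (perm_comp (word_prod s) x).
  by rewrite /perm_comp mulgA.
move=> /= El.
have l1 := perm_length_comp (word_prod s) x.
have l2 := perm_length_comp (simple_transp a) (perm_comp (word_prod s) x).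
have l3 := perm_length_simple a; have l4 := perm_length_le s.
apply: connect_trans (IHs _) _; first by lia.
rewrite left_simple; apply: bruhat_le_tperm; last by rewrite -left_simple; lia.
by rewrite (inj_eq perm_inj) lo_neq_hi.
Qed.

Definition in_interval n (v w z : 'S_n) := bruhat_le v z && bruhat_le z w.

Lemma right_prefix_interval n (v : 'S_n) (s t : seq 'I_n.-1) :
    perm_length (perm_comp v (word_prod (s ++ t)))
      = (perm_length v + size (s ++ t))%N ->
  in_interval v (perm_comp v (word_prod (s ++ t))) (perm_comp v (word_prod s)).
Proof.
rewrite word_prod_cat size_cat.
have -> : perm_comp v (perm_comp (word_prod s) (word_prod t))
          = perm_comp (perm_comp v (word_prod s)) (word_prod t).
  by rewrite /perm_comp mulgA.
have l1 := perm_length_comp v (word_prod s).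
have l2 := perm_length_comp (perm_comp v (word_prod s)) (word_prod t).
have l3 := perm_length_le s; have l4 := perm_length_le t.
by move=> El; apply/andP; split; apply: bruhat_le_right; lia.
Qed.

Lemma left_suffix_interval n (v : 'S_n) (s t : seq 'I_n.-1) :
    perm_length (perm_comp (word_prod (s ++ t)) v)
      = (perm_length v + size (s ++ t))%N ->
  in_interval v (perm_comp (word_prod (s ++ t)) v) (perm_comp (word_prod t) v).
Proof.
rewrite word_prod_cat size_cat.
have -> : perm_comp (perm_comp (word_prod s) (word_prod t)) v
          = perm_comp (word_prod s) (perm_comp (word_prod t) v).
  by rewrite /perm_comp mulgA.
have l1 := perm_length_comp (word_prod t) v.
have l2 := perm_length_comp (word_prod s) (perm_comp (word_prod t) v).
have l3 := perm_length_le s; have l4 := perm_length_le t.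
by move=> El; apply/andP; split; apply: bruhat_le_left; lia.
Qed.

(** * Direction spaces *)

Local Open Scope ring_scope.
Local Open Scope classical_set_scope.

Lemma affine_subspace_convex (R : realType) n (x : 'rV[R]_n) (U : {vspace 'rV[R]_n}) :
  convex_set [set x + u | u in [set` U]].
Proof.
move=> a b l; rewrite !inE => -[u Uu <-] [u' Uu' <-].
exists (l%:num *: u + (1 - l%:num) *: u'); first by apply: memvD; apply: memvZ.
rewrite /conv /= !scalerDr addrACA -scalerDl addrC.
by rewrite [l%:num + _]addrC subrK scale1r addrC.
Qed.

Lemma affine_hull_sub (R : realType) n (A : set 'rV[R]_n) (x : 'rV[R]_n)
    (U : {vspace 'rV[R]_n}) :
    A `<=` [set x + u | u in [set` U]] ->
  affine_hull A `<=` [set x + u | u in [set` U]].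
Proof.
move=> AU y [k [c [p [Ap sc ->]]]].
exists (\sum_(i < k) c i *: (p i - x)).
  apply: memv_suml => i _; apply: memvZ.
  by have [u Uu <-] := AU _ (Ap i); rewrite addrC addKr.
under eq_bigr do rewrite scalerBr.
by rewrite sumrB -scaler_suml sc scale1r addrC subrK.
Qed.

(** A combination of the differences [y - x] becomes an affine combination once
    the missing weight is put on [x], which is given index [0]. *)
Lemma sub_affine_hull (R : realType) n (A : set 'rV[R]_n) (x : 'rV[R]_n)
    (X : seq 'rV[R]_n) :
    A x -> (forall y, y \in X -> A y) ->
  [set x + u | u in [set` <<[seq y - x | y <- X]>>%VS]] `<=` affine_hull A.
Proof.
move=> Ax AX _ [u Uu <-].
pose Y := in_tuple [seq y - x | y <- X].
have /coord_span Eu : u \in <<Y>>%VS by [].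
pose k := size [seq y - x | y <- X].
pose c (i : 'I_k.+1) := oapp (fun i => coord Y i u) (1 - \sum_i coord Y i u)
                              (unlift ord0 i).
pose p (i : 'I_k.+1) := oapp (fun i : 'I_k => Y`_i + x) x (unlift ord0 i).
exists k.+1, c, p; split.
- move=> i; rewrite /p; case: unlift => //= l.
  have /mapP[y Xy ->] : Y`_l \in [seq y - x | y <- X] by apply: mem_nth.
  by rewrite subrK; apply: AX.
- rewrite big_ord_recl /c unlift_none /=.
  by under [X in _ + X]eq_bigr do rewrite liftK /=; rewrite subrK.
- rewrite big_ord_recl /c /p unlift_none /=.
  under [X in _ = _ + X]eq_bigr do rewrite liftK /= scalerDr.
  rewrite big_split /= -Eu -scaler_suml addrCA addrC -scalerDl subrK scale1r.
  by rewrite addrC.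
Qed.

Lemma direction_uniq (R : realType) n (x y : 'rV[R]_n) (U V : {vspace 'rV[R]_n}) :
    [set x + u | u in [set` U]] = [set y + u | u in [set` V]] -> U = V.
Proof.
have sub (x1 y1 : 'rV[R]_n) (U1 V1 : {vspace 'rV[R]_n}) :
    [set x1 + u | u in [set` U1]] = [set y1 + u | u in [set` V1]] -> (U1 <= V1)%VS.
  move=> E; have mem u : u \in U1 -> x1 - y1 + u \in V1.
    move=> U1u; have : [set x1 + u | u in [set` U1]] (x1 + u) by exists u.
    by rewrite E => -[t V1t Et]; rewrite addrAC -Et addrC addKr.
  apply/subvP => u U1u.
  by rewrite -(addKr (x1 - y1) u) memvD ?mem // memvN -[x1 - y1]addr0 mem ?mem0v.
by move=> E; apply/eqP; rewrite eqEsubv (sub _ _ _ _ E) (sub _ _ _ _ (esym E)).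
Qed.

Definition directions (R : realType) n (v w : 'S_n) : {vspace 'rV[R]_n} :=
  <<[seq y - perm_point R v
    | y <- [seq perm_point R z | z <- enum (in_interval v w)]]>>%VS.

Lemma mem_directions (R : realType) n (v w z : 'S_n) :
  in_interval v w z -> perm_point R z - perm_point R v \in directions R v w.
Proof.
move=> vzw; apply: memv_span; apply: map_f; apply: map_f.
by rewrite mem_enum.
Qed.

Lemma affine_hull_polytope (R : realType) n (v w : 'S_n) : bruhat_le v w ->
  affine_hull (bruhat_interval_polytope R v w)
  = [set perm_point R v + u | u in [set` directions R v w]].
Proof.
move=> vw; have ptQ z : in_interval v w z ->
    bruhat_interval_polytope R v w (perm_point R z).
  by case/andP=> vz zw; apply: sub_gen_smallest; exists z.
apply/seteqP; split.
  apply: affine_hull_sub; apply: smallest_sub.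
    exact: affine_subspace_convex.
  move=> _ [z [vz zw] <-]; exists (perm_point R z - perm_point R v).
    by apply: mem_directions; apply/andP.
  by rewrite addrC subrK.
apply: sub_affine_hull.
  by apply: ptQ; rewrite /in_interval vw andbT; apply: connect0.
by move=> y /mapP[z]; rewrite mem_enum => vzw ->; apply: ptQ.
Qed.

Lemma toricE (R : realType) n (v w : 'S_n) : bruhat_le v w ->
  toric R v w <-> \dim (directions R v w) = (perm_length w - perm_length v)%N.
Proof.
move=> vw; rewrite /toric /has_dim affine_hull_polytope //; split.
  by move=> [x [U [/direction_uniq -> <-]]].
by move=> Ed; exists (perm_point R v), (directions R v w).
Qed.

(** * Root spaces *)

(** Indexing unit vectors by the value that [b] has at their position makes the
    roots below independent of [b] in form, and treats both sides at once. *)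
Definition unit_at (R : realType) n (b : 'S_n) (l : 'I_n) : 'rV[R]_n :=
  delta_mx 0 (b^-1 l)%g.

Definition simple_root (R : realType) n (b : 'S_n) (a : 'I_n.-1) : 'rV[R]_n :=
  unit_at R b (lo a) - unit_at R b (hi a).

Lemma perm_point_comp (R : realType) n (a b : 'S_n) :
  perm_point R (perm_comp a b) = \sum_l (a l).+1%:R *: unit_at R b l.
Proof.
rewrite {1}(row_sum_delta (perm_point _ _)).
rewrite (reindex_inj (@perm_inj _ (b^-1)%g)); apply: eq_bigr => l _.
by rewrite mxE perm_compE permKV.
Qed.

(** Walking from [i] to [j] one step at a time, every step is along a letter of
    [s], since a missing letter would be a cut separating [i] from [j]. *)
Lemma unit_at_congr (R : realType) n (b : 'S_n) (s : seq 'I_n.-1)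
    (U : {vspace 'rV[R]_n}) (i j : 'I_n) :
    (forall a, a \in s -> simple_root R b a \in U) ->
    (forall p, cut s p -> (i < p)%N = (j < p)%N) ->
  unit_at R b i - unit_at R b j \in U.
Proof.
move=> sU; wlog leij : i j / (i <= j)%N => [wl nocut | ].
  have [/wl|/ltnW/wl leji] := leqP i j; first exact.
  by rewrite -opprB memvN leji // => p /nocut.
have [d] := ubnPeq (j - i)%N; elim: d i leij => [|d IHd] i leij Ed nocut.
  by rewrite (_ : i = j) ?subrr ?mem0v //; apply: val_inj => /=; lia.
have ltin : (i < n.-1)%N by have := ltn_ord j; lia.
pose a := Ordinal ltin.
have Ei : i = lo a by apply: val_inj.
have sa : a \in s.
  apply/negPn/negP => nsa.
  have /nocut : cut s i.+1; last by lia.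
  move=> c sc; apply: contraNneq nsa => -[/= Ec].
  by rewrite (_ : a = c) //; apply: val_inj.
rewrite -(subrK (unit_at R b (hi a)) (unit_at R b i)) -addrA.
apply: memvD; first by rewrite Ei; apply: sU.
by apply: IHd => [|| p /nocut] /=; lia.
Qed.

(** After reindexing by [y], both points carry the same coefficients, at unit
    vectors that are congruent modulo [U]. *)
Lemma perm_point_block (R : realType) n (a b y : 'S_n) (s : seq 'I_n.-1)
    (U : {vspace 'rV[R]_n}) :
    block_perm s y -> (forall i, i \in s -> simple_root R b i \in U) ->
  perm_point R (perm_comp (perm_comp a y) b) - perm_point R (perm_comp a b) \in U.
Proof.
move=> By sU; rewrite !perm_point_comp [X in _ - X](reindex_inj (@perm_inj _ y)).
rewrite -sumrB; apply: memv_suml => l _; rewrite perm_compE -scalerBr.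
apply/memvZ/(unit_at_congr sU) => p /By /(_ l) <- //.
Qed.

Lemma edge_direction (R : realType) n (v w x : 'S_n) (i j : 'I_n) :
    in_interval v w x -> in_interval v w (perm_comp x (tperm i j)) ->
  delta_mx 0 i - delta_mx 0 j \in directions R v w.
Proof.
move=> Ix Iy; have [->|neij] := eqVneq i j; first by rewrite subrr mem0v.
have c0 : (x j)%:R - (x i)%:R != 0 :> R.
  by rewrite subr_eq0 eqr_nat val_eqE (inj_eq perm_inj) eq_sym.
set e := _ - _.
have -> : e = ((x j)%:R - (x i)%:R)^-1 *:
    (perm_point R (perm_comp x (tperm i j)) - perm_point R x).
  apply: (canRL (scalerK c0)); apply/rowP => k.
  rewrite !mxE /= perm_compE -!natr1 opprD addrACA.
  rewrite subrr addr0; case: tpermP => [->|->|/eqP/negPf ki /eqP/negPf kj].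
  - by rewrite eqxx (negPf neij) subr0 mulr1.
  - by rewrite eqxx eq_sym (negPf neij) sub0r mulrN1 opprB.
  - by rewrite ki kj !subrr mulr0.
apply: memvZ; rewrite -(subrKA (perm_point R v)).
by rewrite memvD ?mem_directions // -opprB memvN mem_directions.
Qed.

Definition root_space (R : realType) n (b : 'S_n) (s : seq 'I_n.-1) :=
  <<[seq simple_root R b a | a <- s]>>%VS.

(** The partial sum of the coordinates up to the position of [a] is [1] on the
    root of [a] and [0] on all the others, so distinct roots are independent. *)
Lemma free_roots (R : realType) n (b : 'S_n) (s : seq 'I_n.-1) :
  uniq s -> free [seq simple_root R b a | a <- s].
Proof.
pose f (a : 'I_n.-1) (x : 'rV[R]_n) : R^o :=
  \sum_(l < n | (l <= a)%N) x 0 ((b^-1)%g l).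
have flin a : linear (f a).
  move=> c x y; rewrite /f scaler_sumr -big_split /=.
  by apply: eq_bigr => l _; rewrite !mxE.
pose F a : {linear 'rV[R]_n -> R^o} :=
  HB.pack (f a) (GRing.isLinear.Build R 'rV[R]_n R^o _ (f a) (flin a)).
have fE a i : f a (unit_at R b i) = (i <= a)%:R.
  rewrite /f /unit_at; under eq_bigr do rewrite mxE eqxx (inj_eq perm_inj) /=.
  have [ia | ia] := boolP (i <= a)%N.
    rewrite (bigD1 i) //= eqxx big1 ?addr0 // => l /andP[_ /negPf ->//].
  by rewrite big1 // => l la; case: eqP => // Eli; rewrite -Eli la in ia.
have froot a c : f a (simple_root R b c) = (a == c)%:R.
  rewrite -[LHS]/(F a (simple_root R b c)) linearB /= !fE /= -val_eqE /=.
  by case: (ltngtP c a) => _ /=; rewrite ?subr0 ?subrr.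
elim: s => [|a s IHs] /=; first by rewrite nil_free.
case/andP=> nas us; rewrite free_cons IHs // andbT.
apply/negP => ain.
have sub : (<<[seq simple_root R b c | c <- s]>> <= lker (linfun (F a)))%VS.
  apply/span_subvP => _ /mapP[c sc ->]; rewrite memv_ker lfunE /= froot.
  have /negPf-> : a != c by apply: contraNneq nas => ->.
  exact: eqxx.
by have := subvP sub _ ain; rewrite memv_ker lfunE /= froot eqxx oner_eq0.
Qed.

Lemma dim_root_space (R : realType) n (b : 'S_n) (s : seq 'I_n.-1) :
  \dim (root_space R b s) = size (undup s).
Proof.
rewrite -(size_map (simple_root R b)).
have /eqP <- := free_roots R b (undup_uniq s).
congr (\dim _); apply: eq_span => x.
by apply/mapP/mapP => -[a sa ->]; exists a; rewrite ?mem_undup // -mem_undup.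
Qed.

(** The edge of the chain that multiplies by the letter [a] on the right exchanges
    positions [a] and [a + 1], and so is parallel to the root of [a]. *)
Lemma directions_right (R : realType) n (v : 'S_n) (s : seq 'I_n.-1) :
    perm_length (perm_comp v (word_prod s)) = (perm_length v + size s)%N ->
  directions R v (perm_comp v (word_prod s)) = root_space R 1 s.
Proof.
move=> El; apply/eqP; rewrite eqEsubv; apply/andP; split; apply/span_subvP.
  move=> _ /mapP[_ /mapP[z + ->] ->]; rewrite mem_enum => /andP[vz zw].
  have [y -> By] := interval_right_coset vz zw.
  have := @perm_point_block R n v 1 y s (root_space R 1 s) By.
  rewrite {1 2 3}/perm_comp !mul1g; apply => a sa.
  by apply: memv_span; apply: map_f.
move=> _ /mapP[a /splitPr sa ->]; case: sa El => s1 s2 El.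
rewrite /simple_root /unit_at invg1 !perm1.
apply: (@edge_direction _ _ _ _ (perm_comp v (word_prod s1))).
  exact: right_prefix_interval.
have := @right_prefix_interval _ v (rcons s1 a) s2.
rewrite cat_rcons -cats1 (word_prod_cat s1 [:: a]) word_prod1 => /(_ El).
by rewrite /perm_comp mulgA.
Qed.

(** Multiplying [y v] by the letter [a] on the left exchanges the positions
    [v^-1 y^-1 a] and [v^-1 y^-1 (a + 1)].  Here [y] is a product of letters
    already treated, so it does not change the unit vectors modulo the roots of
    these letters, and the edge is congruent to the root of [a]. *)
Lemma directions_left (R : realType) n (v : 'S_n) (s : seq 'I_n.-1) :
    perm_length (perm_comp (word_prod s) v) = (perm_length v + size s)%N ->
  directions R v (perm_comp (word_prod s) v) = root_space R v s.
Proof.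
move=> El; apply/eqP; rewrite eqEsubv; apply/andP; split; apply/span_subvP.
  move=> _ /mapP[_ /mapP[z + ->] ->]; rewrite mem_enum => /andP[vz zw].
  have [y -> By] := interval_left_coset vz zw.
  have := @perm_point_block R n 1 v y s (root_space R v s) By.
  rewrite {2 3}/perm_comp !mulg1; apply => a sa.
  by apply: memv_span; apply: map_f.
set D := directions R v _.
(* The word is read from the right; [t] is the part already read. *)
suff rootD t r : s = r ++ t -> forall a, a \in t -> simple_root R v a \in D.
  by move=> _ /mapP[a sa ->]; exact: (rootD s [::]).
elim: t r => [//|a t IHt] r Es.
have tD := IHt (rcons r a); rewrite cat_rcons in tD; have {}tD := tD Es.
move=> c; rewrite inE => /orP[/eqP -> {c} | /tD //].
have Ix : in_interval v (perm_comp (word_prod s) v) (perm_comp (word_prod t) v).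
  have := @left_suffix_interval _ v (rcons r a) t.
  by rewrite cat_rcons -Es; apply.
have Iy : in_interval v (perm_comp (word_prod s) v)
    (perm_comp (word_prod (a :: t)) v).
  by have := @left_suffix_interval _ v r (a :: t); rewrite -Es; apply.
have Ey : perm_comp (word_prod (a :: t)) v
    = perm_comp (simple_transp a) (perm_comp (word_prod t) v).
  by rewrite word_prod_cons /perm_comp mulgA.
rewrite Ey left_simple in Iy; have edge := edge_direction R Ix Iy.
pose y := word_prod t.
have yB p : cut t p -> forall l, ((y^-1)%g l < p)%N = (l < p)%N.
  by move=> /keeps_word kp l; rewrite -kp permKV.
have nearD l : unit_at R v ((y^-1)%g l) - unit_at R v l \in D.
  by apply: (unit_at_congr tD) => p /yB ->.
have Eu l : delta_mx 0 ((perm_comp y v)^-1%g l) = unit_at R v ((y^-1)%g l).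
  by rewrite /unit_at /perm_comp invMg permM.
rewrite !Eu in edge.
have -> : simple_root R v a =
    (unit_at R v ((y^-1)%g (lo a)) - unit_at R v ((y^-1)%g (hi a)))
    - (unit_at R v ((y^-1)%g (lo a)) - unit_at R v (lo a))
    + (unit_at R v ((y^-1)%g (hi a)) - unit_at R v (hi a)).
  by rewrite /simple_root opprB [_ - _ + (_ - _)]addrC subrKA addrA subrK.
apply: memvD (nearD _); exact: memvB edge (nearD _).
Qed.

(** * The dimension of the polytope *)

Theorem proposition7p1 (R : realType) (n m : nat) (v w : 'S_n)
    (j : m.-tuple 'I_n.-1)
    (hw : w = perm_comp v (word_prod j) \/ w = perm_comp (word_prod j) v)
    (hl : perm_length w = (perm_length v + m)%N) :
  uniq j <-> toric R v w.
Proof.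
have [vw [b Edir]] : bruhat_le v w /\ exists b, directions R v w = root_space R b j.
  have : perm_length w = (perm_length v + size j)%N by rewrite size_tuple.
  case: hw => -> {}hl.
    split; first exact: bruhat_le_right.
    by exists 1%g; apply: directions_right.
  split; first exact: bruhat_le_left.
  by exists v; apply: directions_left.
rewrite toricE // Edir dim_root_space hl addKn.
split=> [/undup_id -> | Esize]; first by rewrite size_tuple.
by apply/negPn; rewrite -ltn_size_undup Esize size_tuple ltnn.
Qed.
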